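(* Let $R$ be a commutative artinian ring, let $(\mathcal C,\mathbb E,\mathfrak s)$ be an artin extriangulated $R$-category with enough projectives and enough injectives, let $\Theta=\{\Theta(i)\}_{i=1}^{t}$ be a family of objects in $\mathcal C$, and let $\le$ be a linear order on the set $[1,t]=\{1,\dots,t\}$ such that $\mathbb E(\Theta(j),\Theta(i))=0$ for all $j\ge i$. Then $$\mathfrak F(\Theta)=\ast_{i=1}^{t}\,\Theta^{\oplus}$$ (the $t$-fold product $\Theta^{\oplus}\ast\cdots\ast\Theta^{\oplus}$), and $\mathfrak F(\Theta)$ is functorially finite in $\mathcal C$.
   Context: **Extriangulated categories (Nakaoka–Palu).** Let $\mathcal C$ be an additive category and $\mathbb E:\mathcal C^{\mathrm{op}}\times\mathcal C\to \mathrm{Ab}$ a biadditive functor. An element $\delta\in\mathbb E(C,A)$ is an $\mathbb E$-extension; for $a:A\to A'$ and $c:C'\to C$ write $a_*\delta=\mathbb E(C,a)(\delta)$, $c^*\delta=\mathbb E(c,A)(\delta)$. For $\delta\in\mathbb E(C,A)$, $\delta'\in\mathbb E(C',A')$, a morphism $(a,c):\delta\to\delta'$ is a pair $a:A\to A'$, $c:C\to C'$ with $a_*\delta=c^*\delta'$; $\delta\oplus\delta'\in\mathbb E(C\oplus C',A\oplus A')$ is the element with components $(\delta,0,0,\delta')$ in $\mathbb E(C,A)\oplus\mathbb E(C,A')\oplus\mathbb E(C',A)\oplus\mathbb E(C',A')$. Sequences $A\xrightarrow{x}B\xrightarrow{y}C$ and $A\xrightarrow{x'}B'\xrightarrow{y'}C$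 are equivalent if there is an isomorphism $b:B\to B'$ with $bx=x'$, $y'b=y$; $[A\to B\to C]$ denotes the equivalence class. A realization $\mathfrak s$ assigns to each $\delta\in\mathbb E(C,A)$ a class $\mathfrak s(\delta)=[A\xrightarrow{x}B\xrightarrow{y}C]$ such that for every morphism $(a,c):\delta\to\delta'$, with $\mathfrak s(\delta')=[A'\xrightarrow{x'}B'\xrightarrow{y'}C']$, there is $b:B\to B'$ with $bx=x'a$, $y'b=cy$. It is additive if $\mathfrak s(0)=[A\to A\oplus C\to C]$ (canonical maps) and $\mathfrak s(\delta\oplus\delta')=\mathfrak s(\delta)\oplus\mathfrak s(\delta')$. $(\mathcal C,\mathbb E,\mathfrak s)$ is an extriangulated category if: (ET1) $\mathbb E$ is biadditive; (ET2) $\mathfrak s$ is an additive realization; (ET3) if $\mathfrak s(\delta)=[A\xrightarrow{x}B\xrightarrow{y}C]$, $\mathfrak s(\delta')=[A'\xrightarrow{x'}B'\xrightarrow{y'}C']$ and $bx=x'a$, then there is $c:C\to C'$ with $(a,c):\delta\to\delta'$ a morphism and $cy=y'b$; (ET4) if $\delta\in\mathbb E(D,A)$, $\delta'\in\mathbb E(F,B)$ are realized by $A\xrightarrow{f}B\xrightarrow{f'}D$ and $B\xrightarrow{g}C\xrightarrow{g'}F$, there are an object $E$, morphisms $h=gf:A\to C$, $h':C\to E$, $d:D\to E$, $e:E\to F$ with $h'g=df'$, $eh'=g'$, and $\delta''\in\mathbb E(E,A)$ realized by $A\xrightarrow{h}C\xrightarrow{h'}E$, such that $D\xrightarrow{d}E\xrightarrow{e}F$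 realizes $f'_*\delta'$, $d^*\delta''=\delta$ and $f_*\delta''=e^*\delta'$; and (ET3)$^{\mathrm{op}}$, (ET4)$^{\mathrm{op}}$, the duals of (ET3), (ET4) (obtained by passing to the opposite category). An $\mathbb E$-triangle $A\to B\to C\dashrightarrow$ is a sequence realizing some $\delta\in\mathbb E(C,A)$. **Enough projectives/injectives.** $P$ is projective if for every $\mathbb E$-triangle $A\to B\xrightarrow{y}C\dashrightarrow$ every $P\to C$ factors through $y$. $\mathcal C$ has enough projectives if every $C$ admits an $\mathbb E$-triangle $A\to P\to C\dashrightarrow$ with $P$ projective. Injectives and enough injectives are defined dually. **Artin extriangulated $R$-category.** An extriangulated category which is an $R$-category (Hom sets are $R$-modules, composition is $R$-bilinear), with $\mathbb E$ an $R$-bilinear functor into $R$-modules, such that all $\mathrm{Hom}_{\mathcal C}(X,Y)$ and all $\mathbb E(X,Y)$ are finitely generated $R$-modules, and $\mathcal C$ is Krull–Schmidt (every object is a finite direct sum of objects with local endomorphism rings). **Filtered objects.** For a class $\mathcal X$ of objects, $\mathfrak F(\mathcal X)$ is the class (full subcategory) of objects $M$ admitting an $\mathcal X$-filtration: a family of $\mathbb E$-triangles $\{M_{i-1}\to M_i\to X_i\dashrightarrow\}_{i=0}^{m}$ with $M_{-1}=0=X_0$, $M_m=M$ and $X_i\in\mathcal X$ for $i\ge1$. **Products and sums.** $\mathcal X\ast\mathcal Y$ is the class of objects $A$ for which there is an $\mathbb E$-triangle $X\to A\to Y\dashrightarrow$ with $X\in\mathcal X$, $Y\in\mathcal Y$;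 this operation is associative. $\Theta^{\oplus}$ is the full subcategory of all objects isomorphic to finite direct sums (including the zero object) of copies of objects in $\Theta$. **Functorially finite.** An $\mathcal X$-precover of $C$ is a morphism $f:X\to C$ with $X\in\mathcal X$ such that $\mathrm{Hom}_{\mathcal C}(X',X)\to\mathrm{Hom}_{\mathcal C}(X',C)$ is surjective for all $X'\in\mathcal X$; $\mathcal X$ is precovering in $\mathcal C$ if every object of $\mathcal C$ has an $\mathcal X$-precover. $\mathcal X$-preenvelopes and preenveloping classes are defined dually. $\mathcal X$ is functorially finite in $\mathcal C$ if it is both precovering and preenveloping. *)

(* Defs.v *)
From HB Require Import structures.
From mathcomp Require Import all_boot all_order all_algebra.

Set Implicit Arguments.
Unset Strict Implicit.
Unset Printing Implicit Defensive.

Import GRing.Theory.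
Local Open Scope ring_scope.

(** * Rings and modules *)

Definition is_ideal (R : comPzRingType) (I : R -> Prop) : Prop :=
  [/\ I 0, forall x y, I x -> I y -> I (x + y) & forall a x, I x -> I (a * x)].

Definition artinian (R : comPzRingType) : Prop :=
  forall I : nat -> R -> Prop,
    (forall n, is_ideal (I n)) -> (forall n x, I n.+1 x -> I n x) ->
    exists N, forall n x, (N <= n)%N -> I N x -> I n x.

Definition fin_gen (R : comPzRingType) (M : lmodType R) : Prop :=
  exists (n : nat) (v : 'I_n -> M),
    forall m : M, exists c : 'I_n -> R, m = \sum_(i < n) c i *: v i.

(** * Additive R-categories *)

(** The zero object and the binary biproducts are part of the structure, so
    that [delta (+) delta'] below is an element of a definite module. *)
Record addCat (R : comPzRingType) := AddCat {
  obj :> Type;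
  mor : obj -> obj -> lmodType R;
  idm : forall A, mor A A;
  mcomp : forall A B D, mor B D -> mor A B -> mor A D;
  mcomp1m : forall A B (f : mor A B), mcomp (idm B) f = f;
  mcompm1 : forall A B (f : mor A B), mcomp f (idm A) = f;
  mcompA : forall A B D F (h : mor D F) (g : mor B D) (f : mor A B),
    mcomp h (mcomp g f) = mcomp (mcomp h g) f;
  mcompPl : forall A B D (a : R) (g g' : mor B D) (f : mor A B),
    mcomp (a *: g + g') f = a *: mcomp g f + mcomp g' f;
  mcompPr : forall A B D (a : R) (g : mor B D) (f f' : mor A B),
    mcomp g (a *: f + f') = a *: mcomp g f + mcomp g f';
  zob : obj;
  zob_initial : forall A (f : mor zob A), f = 0;
  zob_terminal : forall A (f : mor A zob), f = 0;
  bip : obj -> obj -> obj;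
  inl_ : forall A B, mor A (bip A B);
  inr_ : forall A B, mor B (bip A B);
  prl_ : forall A B, mor (bip A B) A;
  prr_ : forall A B, mor (bip A B) B;
  prl_inl : forall A B, mcomp (prl_ A B) (inl_ A B) = idm A;
  prr_inr : forall A B, mcomp (prr_ A B) (inr_ A B) = idm B;
  prl_inr : forall A B, mcomp (prl_ A B) (inr_ A B) = 0;
  prr_inl : forall A B, mcomp (prr_ A B) (inl_ A B) = 0;
  bip_id : forall A B,
    mcomp (inl_ A B) (prl_ A B) + mcomp (inr_ A B) (prr_ A B) = idm (bip A B)
}.

Arguments mor {R _}.
Arguments idm {R _}.
Arguments mcomp {R _ A B D}.
Arguments zob {R}.
Arguments bip {R _}.
Arguments inl_ {R _}.
Arguments inr_ {R _}.
Arguments prl_ {R _}.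
Arguments prr_ {R _}.

Notation "g \oc f" := (mcomp g f) (at level 40, left associativity).

Program Definition opCat (R : comPzRingType) (C : addCat R) : addCat R :=
  {| obj := C;
     mor := fun A B => @mor R C B A;
     idm := fun A => idm A;
     mcomp := fun A B D g f => f \oc g;
     zob := zob C;
     bip := bip;
     inl_ := fun A B => prl_ A B;
     inr_ := fun A B => prr_ A B;
     prl_ := fun A B => inl_ A B;
     prr_ := fun A B => inr_ A B |}.
Next Obligation. by move=> *; apply: mcompm1. Qed.
Next Obligation. by move=> *; apply: mcomp1m. Qed.
Next Obligation. by move=> * /=; rewrite mcompA. Qed.
Next Obligation. by move=> *; apply: mcompPr. Qed.
Next Obligation. by move=> *; apply: mcompPl. Qed.
Next Obligation. by move=> *; apply: zob_terminal. Qed.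
Next Obligation. by move=> *; apply: zob_initial. Qed.
Next Obligation. by move=> *; apply: prl_inl. Qed.
Next Obligation. by move=> *; apply: prr_inr. Qed.
Next Obligation. by move=> *; apply: prr_inl. Qed.
Next Obligation. by move=> *; apply: prl_inr. Qed.
Next Obligation. by move=> *; apply: bip_id. Qed.

Section Category.
Variables (R : comPzRingType) (C : addCat R).

Definition is_iso (A B : C) (f : mor A B) : Prop :=
  exists g : mor B A, g \oc f = idm A /\ f \oc g = idm B.

Definition isomorphic (A B : C) : Prop := exists f : mor A B, is_iso f.

Definition is_zero (Z : C) : Prop :=
  (forall (A : C) (f : mor Z A), f = 0) /\ (forall (A : C) (f : mor A Z), f = 0).

Definition map_bip (A B A' B' : C) (f : mor A B) (f' : mor A' B') :
    mor (bip A A') (bip B B') :=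
  inl_ B B' \oc f \oc prl_ A A' + inr_ B B' \oc f' \oc prr_ A A'.

Definition sums_of (X : C -> Prop) (M : C) : Prop :=
  exists (n : nat) (F : 'I_n -> C),
    (forall i, X (F i)) /\ isomorphic M (\big[bip/zob C]_(i < n) F i).

(** A ring is local when it is nonzero and its non-units are closed under
    addition. *)
Definition local_end (X : C) : Prop :=
  idm X <> 0 /\
  (forall f g : mor X X, ~ is_iso f -> ~ is_iso g -> ~ is_iso (f + g)).

Definition krull_schmidt : Prop := forall M : C, sums_of local_end M.

Definition precover (X : C -> Prop) (D Y : C) (f : mor Y D) : Prop :=
  X Y /\ (forall Y' : C, X Y' -> forall g : mor Y' D, exists h, g = f \oc h).

Definition precovering (X : C -> Prop) : Prop :=
  forall D : C, exists (Y : C) (f : mor Y D), precover X f.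

End Category.

Definition preenveloping (R : comPzRingType) (C : addCat R) (X : C -> Prop) :=
  @precovering R (opCat C) X.

Definition functorially_finite (R : comPzRingType) (C : addCat R)
    (X : C -> Prop) : Prop :=
  precovering X /\ preenveloping X.

(** * Bilinear functors [C^op x C -> R-Mod] *)

(** [E D A] is contravariant in [D] through [pull] and covariant in [A]
    through [push]. *)
Record bifun (R : comPzRingType) (C : addCat R) := Bifun {
  ext :> C -> C -> lmodType R;
  push : forall D A A', mor A A' -> ext D A -> ext D A';
  pull : forall D D' A, mor D' D -> ext D A -> ext D' A;
  push1 : forall D A (d : ext D A), push (idm A) d = d;
  pull1 : forall D A (d : ext D A), pull (idm D) d = d;
  push_comp : forall D A A' A'' (a' : mor A' A'') (a : mor A A') (d : ext D A),
    push (a' \oc a) d = push a' (push a d);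
  pull_comp : forall D D' D'' A (c : mor D' D) (c' : mor D'' D') (d : ext D A),
    pull (c \oc c') d = pull c' (pull c d);
  push_pull : forall D D' A A' (a : mor A A') (c : mor D' D) (d : ext D A),
    push a (pull c d) = pull c (push a d);
  pushP : forall D A A' (a : mor A A') (r : R) (d d' : ext D A),
    push a (r *: d + d') = r *: push a d + push a d';
  pullP : forall D D' A (c : mor D' D) (r : R) (d d' : ext D A),
    pull c (r *: d + d') = r *: pull c d + pull c d';
  pushPm : forall D A A' (r : R) (a a' : mor A A') (d : ext D A),
    push (r *: a + a') d = r *: push a d + push a' d;
  pullPm : forall D D' A (r : R) (c c' : mor D' D) (d : ext D A),
    pull (r *: c + c') d = r *: pull c d + pull c' d
}.

Arguments push {R C _ D A A'}.
Arguments pull {R C _ D D' A}.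

Program Definition opBifun (R : comPzRingType) (C : addCat R) (E : bifun C) :
    bifun (opCat C) :=
  {| ext := fun A D => E D A;
     push := fun A D D' (c : @mor R C D' D) d => pull c d;
     pull := fun A A' D (a : @mor R C A A') d => push a d |}.
Next Obligation. by move=> *; apply: pull1. Qed.
Next Obligation. by move=> *; apply: push1. Qed.
Next Obligation. by move=> *; apply: pull_comp. Qed.
Next Obligation. by move=> *; apply: push_comp. Qed.
Next Obligation. by move=> * /=; rewrite push_pull. Qed.
Next Obligation. by move=> *; apply: pullP. Qed.
Next Obligation. by move=> *; apply: pushP. Qed.
Next Obligation. by move=> *; apply: pullPm. Qed.
Next Obligation. by move=> *; apply: pushPm. Qed.

Section DirectSum.
Variables (R : comPzRingType) (C : addCat R) (E : bifun C).
Variables (D A D' A' : C) (d : E D A) (d' : E D' A').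

Definition ext_sum : E (bip D D') (bip A A') :=
  push (inl_ A A') (pull (prl_ D D') d) + push (inr_ A A') (pull (prr_ D D') d').

Lemma push0m (X Y Z : C) (e : E X Y) : push (0 : mor Y Z) e = 0.
Proof.
have := pushPm (-1) (0 : mor Y Z) 0 e.
by rewrite scaler0 addr0 scaleN1r addNr.
Qed.

Lemma pull0m (X Y Z : C) (e : E X Y) : pull (0 : mor Z X) e = 0.
Proof.
have := pullPm (-1) (0 : mor Z X) 0 e.
by rewrite scaler0 addr0 scaleN1r addNr.
Qed.

Lemma pushD (X Y Z : C) (a : mor Y Z) (e e' : E X Y) :
  push a (e + e') = push a e + push a e'.
Proof. by have := pushP a 1 e e'; rewrite !scale1r. Qed.

Lemma pullD (X Y Z : C) (c : mor Z X) (e e' : E X Y) :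
  pull c (e + e') = pull c e + pull c e'.
Proof. by have := pullP c 1 e e'; rewrite !scale1r. Qed.

Lemma ext_sum_components :
  [/\ pull (inl_ D D') (push (prl_ A A') ext_sum) = d,
      pull (inl_ D D') (push (prr_ A A') ext_sum) = 0,
      pull (inr_ D D') (push (prl_ A A') ext_sum) = 0 &
      pull (inr_ D D') (push (prr_ A A') ext_sum) = d'].
Proof.
by split; rewrite /ext_sum !pushD !pullD -!push_comp -!push_pull -!pull_comp
  ?(prl_inl, prr_inr, prl_inr, prr_inl) ?(push1, pull1, push0m, pull0m)
  ?(push1, pull1, push0m, pull0m) ?(addr0, add0r) //;
  rewrite push_pull push0m pull0m ?(addr0, add0r).
Qed.

End DirectSum.

(** * Realizations and extriangulated categories *)

(** [s d x y] reads "[s(d)] is the class of [A -x-> B -y-> D]". *)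
Definition realT (R : comPzRingType) (C : addCat R) (E : bifun C) :=
  forall (D A : C), E D A -> forall B : C, mor A B -> mor B D -> Prop.

Definition opReal (R : comPzRingType) (C : addCat R) (E : bifun C)
    (s : realT E) : realT (opBifun E) :=
  fun A D d B y x => s D A d B x y.

Definition seq_equiv (R : comPzRingType) (C : addCat R) (A D B B' : C)
    (x : mor A B) (y : mor B D) (x' : mor A B') (y' : mor B' D) : Prop :=
  exists b : mor B B', [/\ is_iso b, b \oc x = x' & y' \oc b = y].

Section Extriangulated.
Variables (R : comPzRingType) (C : addCat R) (E : bifun C) (s : realT E).

Definition ext_morphism (D A D' A' : C) (d : E D A) (d' : E D' A')
    (a : mor A A') (c : mor D D') : Prop :=
  push a d = pull c d'.

(** [s d] is exactly one equivalence class of sequences. *)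
Definition class_valued : Prop :=
  forall (D A : C) (d : E D A),
    exists (B : C) (x : mor A B) (y : mor B D),
      forall (B' : C) (x' : mor A B') (y' : mor B' D),
        s d x' y' <-> seq_equiv x y x' y'.

Definition is_realization : Prop :=
  class_valued /\
  forall (D A D' A' : C) (d : E D A) (d' : E D' A') (a : mor A A')
      (c : mor D D') (B B' : C) (x : mor A B) (y : mor B D)
      (x' : mor A' B') (y' : mor B' D'),
    ext_morphism d d' a c -> s d x y -> s d' x' y' ->
    exists b : mor B B', b \oc x = x' \oc a /\ y' \oc b = c \oc y.

Definition is_additive : Prop :=
  (forall D A : C, s (0 : E D A) (inl_ A D) (prr_ A D)) /\
  (forall (D A D' A' : C) (d : E D A) (d' : E D' A') (B B' : C)
      (x : mor A B) (y : mor B D) (x' : mor A' B') (y' : mor B' D'),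
    s d x y -> s d' x' y' -> s (ext_sum d d') (map_bip x x') (map_bip y y')).

Definition ET2 : Prop := is_realization /\ is_additive.

Definition ET3 : Prop :=
  forall (D A D' A' : C) (d : E D A) (d' : E D' A') (B B' : C)
      (x : mor A B) (y : mor B D) (x' : mor A' B') (y' : mor B' D')
      (a : mor A A') (b : mor B B'),
    s d x y -> s d' x' y' -> b \oc x = x' \oc a ->
    exists c : mor D D', ext_morphism d d' a c /\ c \oc y = y' \oc b.

Definition ET4 : Prop :=
  forall (A B D K F : C) (d : E D A) (d' : E F B)
      (f : mor A B) (f' : mor B D) (g : mor B K) (g' : mor K F),
    s d f f' -> s d' g g' ->
    exists (G : C) (h : mor A K) (h' : mor K G) (u : mor D G) (v : mor G F)
        (d'' : E G A),
      [/\ h = g \oc f, h' \oc g = u \oc f' & v \oc h' = g'] /\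
      [/\ s d'' h h', s (push f' d') u v, pull u d'' = d
        & push f d'' = pull v d'].

Definition etriangle (A B D : C) (x : mor A B) (y : mor B D) : Prop :=
  exists d : E D A, s d x y.

Definition projective (P : C) : Prop :=
  forall (A B D : C) (x : mor A B) (y : mor B D), etriangle x y ->
    forall p : mor P D, exists q : mor P B, p = y \oc q.

Definition enough_projectives : Prop :=
  forall D : C, exists (A P : C) (x : mor A P) (y : mor P D),
    projective P /\ etriangle x y.

Definition star (X Y : C -> Prop) (M : C) : Prop :=
  exists (A D : C) (x : mor A M) (y : mor M D),
    [/\ X A, Y D & etriangle x y].

(** The empty product is the class of zero objects. *)
Fixpoint star_pow (n : nat) (X : C -> Prop) : C -> Prop :=
  match n with
  | 0 => @is_zero R C
  | 1 => X
  | n'.+1 => star X (star_pow n' X)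
  end.

(** Indices are shifted by one: [M k] is the filtration term of index
    [k - 1], so that the [i]-th triangle is [M i -> M i.+1 -> Y i]. *)
Definition filtered (X : C -> Prop) (N : C) : Prop :=
  exists (m : nat) (M Y : nat -> C),
    [/\ is_zero (M 0), is_zero (Y 0) & M m.+1 = N] /\
    (forall i, (0 < i <= m)%N -> X (Y i)) /\
    (forall i, (i <= m)%N ->
       exists (x : mor (M i) (M i.+1)) (y : mor (M i.+1) (Y i)), etriangle x y).

End Extriangulated.

Definition enough_injectives (R : comPzRingType) (C : addCat R) (E : bifun C)
    (s : realT E) : Prop :=
  enough_projectives (opReal s).

(** (ET1) is part of [bifun]. *)
Definition extriangulated (R : comPzRingType) (C : addCat R) (E : bifun C)
    (s : realT E) : Prop :=
  [/\ ET2 s, ET3 s & ET4 s] /\ (ET3 (opReal s) /\ ET4 (opReal s)).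

Definition artin_extriangulated (R : comPzRingType) (C : addCat R)
    (E : bifun C) (s : realT E) : Prop :=
  [/\ extriangulated s,
      forall X Y : C, fin_gen (mor X Y),
      forall X Y : C, fin_gen (E X Y)
    & krull_schmidt C].

Definition range_of (I T : Type) (F : I -> T) (X : T) : Prop :=
  exists i, X = F i.

Definition linear_order (T : Type) (le : rel T) : Prop :=
  [/\ reflexive le, antisymmetric le, transitive le & total le].

(* Main.v *)
(* A filtration by Theta is rearranged by splitting off the largest index k: as
   E(Theta(k), Theta(i)) = 0 for all i <= k, (ET4) and its dual let all copies of
   Theta(k) slide to the bottom, where they form a direct sum, and what remains
   is filtered by smaller indices. Conversely, F(Theta) is closed under
   extensions by the dual of (ET4). Since each Hom(Theta(i), D) is finitely
   generated, finite direct sums of the Theta(i) form a precovering class, and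
   when there are enough injectives X * Y is precovering if X and Y are; the
   preenveloping property is the dual statement. *)

Require Import Defs.
From HB Require Import structures.
From mathcomp Require Import all_boot all_order all_algebra.

Set Implicit Arguments.
Unset Strict Implicit.
Unset Printing Implicit Defensive.

Import GRing.Theory.
Local Open Scope ring_scope.

(** * Biproducts, zero objects, finite direct sums and their precovers *)

Section AdditiveCategory.
Context {R : comPzRingType} {C : addCat R}.
Implicit Types A B D M N Z : C.

Lemma mcompDl A B D (g g' : mor B D) (f : mor A B) :
  (g + g') \oc f = g \oc f + g' \oc f.
Proof. by have := mcompPl 1 g g' f; rewrite !scale1r. Qed.

Lemma mcompDr A B D (g : mor B D) (f f' : mor A B) :
  g \oc (f + f') = g \oc f + g \oc f'.
Proof. by have := mcompPr 1 g f f'; rewrite !scale1r. Qed.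

Lemma mcomp0m A B D (f : mor A B) : (0 : mor B D) \oc f = 0.
Proof. by apply: (addrI (0 \oc f)); rewrite -mcompDl !addr0. Qed.

Lemma mcompm0 A B D (g : mor B D) : g \oc (0 : mor A B) = 0.
Proof. by apply: (addrI (g \oc 0)); rewrite -mcompDr !addr0. Qed.

Lemma mcompNr A B D (g : mor B D) (f : mor A B) : g \oc (- f) = - (g \oc f).
Proof. by apply: (addrI (g \oc f)); rewrite -mcompDr !subrr mcompm0. Qed.

Lemma mcompZr A B D (a : R) (g : mor B D) (f : mor A B) :
  g \oc (a *: f) = a *: (g \oc f).
Proof. by have := mcompPr a g f 0; rewrite mcompm0 !addr0. Qed.

Lemma mcomp_sumr A B D n (g : mor B D) (f : 'I_n -> mor A B) :
  g \oc (\sum_(i < n) f i) = \sum_(i < n) g \oc f i.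
Proof. by elim/big_ind2: _ => [|? f1 ? f2 <- <-|//]; rewrite ?mcompm0 ?mcompDr. Qed.

Definition copair A B D (f : mor A D) (g : mor B D) : mor (bip A B) D :=
  f \oc prl_ A B + g \oc prr_ A B.

Definition pair A B D (f : mor D A) (g : mor D B) : mor D (bip A B) :=
  inl_ A B \oc f + inr_ A B \oc g.

Lemma copair_inl A B D (f : mor A D) (g : mor B D) : copair f g \oc inl_ A B = f.
Proof. by rewrite mcompDl -!mcompA prl_inl prr_inl mcompm0 mcompm1 addr0. Qed.

Lemma copair_inr A B D (f : mor A D) (g : mor B D) : copair f g \oc inr_ A B = g.
Proof. by rewrite mcompDl -!mcompA prl_inr prr_inr mcompm0 mcompm1 add0r. Qed.

Lemma prl_pair A B D (f : mor D A) (g : mor D B) : prl_ A B \oc pair f g = f.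
Proof. by rewrite mcompDr !mcompA prl_inl prl_inr mcomp0m mcomp1m addr0. Qed.

Lemma prr_pair A B D (f : mor D A) (g : mor D B) : prr_ A B \oc pair f g = g.
Proof. by rewrite mcompDr !mcompA prr_inr prr_inl mcomp0m mcomp1m add0r. Qed.

Lemma bip_ext A B D (f g : mor (bip A B) D) :
  f \oc inl_ A B = g \oc inl_ A B -> f \oc inr_ A B = g \oc inr_ A B -> f = g.
Proof.
move=> fgl fgr; rewrite -(mcompm1 f) -(mcompm1 g) -bip_id !mcompDr !mcompA.
by rewrite fgl fgr.
Qed.

Lemma is_iso_id A : is_iso (idm A).
Proof. by exists (idm A); rewrite mcomp1m. Qed.

Lemma is_iso_comp A B D (g : mor B D) (f : mor A B) :
  is_iso g -> is_iso f -> is_iso (g \oc f).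
Proof.
move=> [g' [gK Kg]] [f' [fK Kf]]; exists (f' \oc g'); split.
  by rewrite -mcompA (mcompA g') gK mcomp1m.
by rewrite -mcompA (mcompA f) Kf mcomp1m.
Qed.

Lemma isomorphic_sym A B : isomorphic A B -> isomorphic B A.
Proof. by case=> f [g [gf fg]]; exists g, f. Qed.

Lemma isomorphic_trans B A D :
  isomorphic A B -> isomorphic B D -> isomorphic A D.
Proof. by case=> f f_iso [g g_iso]; exists (g \oc f); apply: is_iso_comp. Qed.

Definition swap A B : mor (bip A B) (bip B A) :=
  copair (inr_ B A) (inl_ B A).

Lemma swap_inl A B : swap A B \oc inl_ A B = inr_ B A.
Proof. exact: copair_inl. Qed.

Lemma swap_inr A B : swap A B \oc inr_ A B = inl_ B A.
Proof. exact: copair_inr. Qed.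

Lemma swapK A B : swap B A \oc swap A B = idm (bip A B).
Proof.
by apply: bip_ext; rewrite mcomp1m -mcompA ?swap_inl ?swap_inr ?swap_inl.
Qed.

Lemma swap_iso A B : is_iso (swap A B).
Proof. by exists (swap B A); rewrite !swapK. Qed.

Lemma prl_swap A B : prl_ B A \oc swap A B = prr_ A B.
Proof.
apply: bip_ext; rewrite -mcompA ?swap_inl ?swap_inr.
  by rewrite prl_inr prr_inl.
by rewrite prl_inl prr_inr.
Qed.

Lemma zob_zero : is_zero (zob C).
Proof. by split=> A f; [apply: zob_initial|apply: zob_terminal]. Qed.

Lemma is_zero_id Z : is_zero Z -> idm Z = 0.
Proof. by case. Qed.

Lemma id0_is_zero Z : idm Z = 0 -> is_zero Z.
Proof.
move=> Z0; split=> A f; first by rewrite -(mcompm1 f) Z0 mcompm0.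
by rewrite -(mcomp1m f) Z0 mcomp0m.
Qed.

Lemma is_zero_iso A B : isomorphic A B -> is_zero B -> is_zero A.
Proof.
case=> f [g [gf fg]] [B0 _]; apply: id0_is_zero.
by rewrite -gf (B0 _ g) mcomp0m.
Qed.

Lemma is_zero_isomorphic A B : is_zero A -> is_zero B -> isomorphic A B.
Proof.
move=> A0 B0; exists 0, 0; rewrite !mcomp0m.
by rewrite (is_zero_id A0) (is_zero_id B0).
Qed.

Lemma inl_iso A Z : is_zero Z -> is_iso (inl_ A Z).
Proof.
move=> Z0; exists (prl_ A Z); split; first exact: prl_inl.
by rewrite -bip_id (proj2 Z0 _ (prr_ A Z)) mcompm0 addr0.
Qed.

Lemma bip_isor A B B' : isomorphic B B' -> isomorphic (bip A B) (bip A B').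
Proof.
case=> f [g [gf fg]].
pose h (X Y : C) (u : mor X Y) := copair (inl_ A Y) (inr_ A Y \oc u).
have hK (X Y : C) (u : mor X Y) (v : mor Y X) :
  v \oc u = idm X -> h _ _ v \oc h _ _ u = idm _.
  move=> vu; apply: bip_ext; rewrite -mcompA mcomp1m /h.
    by rewrite !copair_inl.
  by rewrite copair_inr mcompA copair_inr -mcompA vu mcompm1.
by exists (h _ _ f), (h _ _ g); rewrite !hK.
Qed.

Lemma sums_of_iso (X : C -> Prop) M N :
  isomorphic M N -> sums_of X N -> sums_of X M.
Proof.
move=> MN [n [F [XF NF]]]; exists n, F; split=> //.
exact: isomorphic_trans NF.
Qed.

Lemma sums_of_zero (X : C -> Prop) Z : is_zero Z -> sums_of X Z.
Proof.
move=> Z0; exists 0, (fun _ => zob C); split; first by case.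
by rewrite big_ord0; apply: is_zero_isomorphic Z0 zob_zero.
Qed.

Lemma sums_of_cons (X : C -> Prop) A M :
  X A -> sums_of X M -> sums_of X (bip A M).
Proof.
move=> XA [n [F [XF MF]]].
exists n.+1, (fun i => if unlift ord0 i is Some j then F j else A); split.
  by move=> i; case: unliftP.
rewrite big_ord_recl unlift_none; under eq_bigr do rewrite liftK.
exact: bip_isor.
Qed.

(** Trades the indexed family in [sums_of] for an induction on the number of summands. Invariance of
    [P] is assumed because a sum is only given up to isomorphism. *)
Lemma sums_of_ind (X P : C -> Prop) :
  (forall M N, isomorphic M N -> P N -> P M) -> P (zob C) ->
  (forall A M, X A -> P M -> P (bip A M)) ->
  forall M, sums_of X M -> P M.
Proof.
move=> Piso P0 Pcons M [n [F [XF MF]]]; apply: Piso MF _.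
elim: n F XF => [|n IHn] F XF; first by rewrite big_ord0.
by rewrite big_ord_recl; apply: Pcons => //; apply: IHn => i.
Qed.

Lemma eq_precovering (X Y : C -> Prop) :
  (forall M, X M <-> Y M) -> precovering X -> precovering Y.
Proof.
move=> XY preX D; have [M [f [XM fP]]] := preX D; exists M, f; split.
  exact/XY.
by move=> M' /XY; apply: fP.
Qed.

Lemma precovering_zero : precovering (@is_zero R C).
Proof.
move=> D; exists (zob C), 0; split; first exact: zob_zero.
by move=> Z Z0 g; exists 0; rewrite mcompm0 (proj1 Z0 _ g).
Qed.

(** One copy of [A] is added to [M] for each generator of [mor A D], and the generator is the map on
    that copy. All other morphisms [A -> D] then factor by linearity. *)
Lemma sums_of_absorb (X : C -> Prop) A D M (f : mor M D) :
  X A -> fin_gen (mor A D) -> sums_of X M ->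
  exists N (h : mor N D), [/\ sums_of X N, exists k, f = h \oc k &
    forall g : mor A D, exists k, g = h \oc k].
Proof.
move=> XA [n [v genv]] XM.
suff [N [h [XN fh vh]]] : exists N (h : mor N D), [/\ sums_of X N,
    exists k, f = h \oc k & forall i, exists k, v i = h \oc k].
  exists N, h; split=> // g; have [c ->] := genv g.
  (* The factorizations of the finitely many generators are collected into one function by induction
     on [n], so no axiom of choice is used. *)
  suff [w wE] : exists w : 'I_n -> mor A N, forall i, v i = h \oc w i.
    exists (\sum_i c i *: w i); rewrite mcomp_sumr.
    by apply: eq_bigr => i _; rewrite mcompZr wE.
  clear -vh; elim: n v vh => [|n IHn] v vh.
    by exists (fun _ => 0); case.
  have [k0 k0E] := vh ord0.
  have [w wE] := IHn (fun i => v (lift ord0 i)) (fun i => vh (lift ord0 i)).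
  exists (fun i => if unlift ord0 i is Some j then w j else k0) => i.
  by case: unliftP => [j|] ->.
clear genv; elim: n v => [|n IHn] v.
  exists M, f; split=> //; last by case.
  by exists (idm M); rewrite mcompm1.
have [N [h [XN [k kE] vh]]] := IHn (fun i => v (lift ord0 i)).
exists (bip A N), (copair (v ord0) h); split; first exact: sums_of_cons.
  by exists (inr_ A N \oc k); rewrite mcompA copair_inr.
move=> i; case: (unliftP ord0 i) => [j|] ->.
  by have [l lE] := vh j; exists (inr_ A N \oc l); rewrite mcompA copair_inr.
by exists (inl_ A N); rewrite copair_inl.
Qed.

(** Starting from the zero object, [sums_of_absorb] is applied to each index in turn. Being able to
    lift from every [Theta i] gives lifts from their sums, by the universal property of the
    biproduct. *)
Lemma precovering_sums (t : nat) (Theta : 'I_t -> C) :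
  (forall X Y : C, fin_gen (mor X Y)) ->
  precovering (sums_of (range_of Theta)).
Proof.
move=> fg D.
have [M [f [XM fP]]] : exists M (f : mor M D),
    sums_of (range_of Theta) M /\
    forall i, i \in enum 'I_t -> forall g : mor (Theta i) D, exists k, g = f \oc k.
  elim: (enum _) => [|i l [M [f [XM fP]]]].
    exists (zob C), 0; split=> //; exact: sums_of_zero zob_zero.
  have [|N [h [XN [k kE] hP]]] :=
      sums_of_absorb f _ (fg (Theta i) D) XM.
    by exists i.
  exists N, h; split=> // j; rewrite inE => /predU1P[->//|/fP jP] g.
  by have [u ->] := jP g; exists (k \oc u); rewrite mcompA -kE.
exists M, f; split=> // Y'; move: Y'; apply: sums_of_ind.
- move=> A B [u [v [vu uv]]] BP g; have [k kE] := BP (g \oc v).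
  by exists (k \oc u); rewrite mcompA -kE -mcompA vu mcompm1.
- by move=> g; exists 0; rewrite mcompm0; apply: zob_initial.
move=> _ N [i ->] NP g.
have [k kE] := fP i (mem_enum _ _) (g \oc inl_ _ _).
have [l lE] := NP (g \oc inr_ _ _).
exists (copair k l); apply: bip_ext; rewrite -mcompA.
  by rewrite copair_inl.
by rewrite copair_inr.
Qed.

End AdditiveCategory.

(** * Equivalence of sequences and basic properties of E-triangles *)

Lemma seq_equiv_sym (R : comPzRingType) (C : addCat R) (A D B B' : C)
    (x : mor A B) (y : mor B D) (x' : mor A B') (y' : mor B' D) :
  seq_equiv x y x' y' -> seq_equiv x' y' x y.
Proof.
case=> b [[b' [b'b bb']] bx yb]; exists b'; split; first by exists b.
  by rewrite -bx mcompA b'b mcomp1m.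
by rewrite -yb -mcompA bb' mcompm1.
Qed.

Lemma seq_equiv_trans (R : comPzRingType) (C : addCat R) (A D B1 B2 B3 : C)
    (x1 : mor A B1) (y1 : mor B1 D) (x2 : mor A B2) (y2 : mor B2 D)
    (x3 : mor A B3) (y3 : mor B3 D) :
  seq_equiv x1 y1 x2 y2 -> seq_equiv x2 y2 x3 y3 -> seq_equiv x1 y1 x3 y3.
Proof.
case=> b [b_iso bx yb] [c [c_iso cx yc]]; exists (c \oc b); split.
- exact: is_iso_comp.
- by rewrite -mcompA bx.
- by rewrite mcompA yc.
Qed.

Section Realization.
Context {R : comPzRingType} {C : addCat R} {E : bifun C} {s : realT E}.
Hypothesis exS : extriangulated s.
Implicit Types A B D F G K M N Z : C.

Lemma real_equiv A D (d : E D A) B B' (x : mor A B) (y : mor B D)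
    (x' : mor A B') (y' : mor B' D) :
  s d x y -> seq_equiv x y x' y' -> s d x' y'.
Proof.
have [[[[clS _] _] _ _] _] := exS.
have [B0 [x0 [y0 s0]]] := clS _ _ d.
by move=> xy eq_xy; apply/s0; apply: seq_equiv_trans eq_xy; apply/s0.
Qed.

Lemma real_unique A D (d : E D A) B B' (x : mor A B) (y : mor B D)
    (x' : mor A B') (y' : mor B' D) :
  s d x y -> s d x' y' -> seq_equiv x y x' y'.
Proof.
have [[[[clS _] _] _ _] _] := exS.
have [B0 [x0 [y0 s0]]] := clS _ _ d.
move=> xy xy'; apply: (@seq_equiv_trans _ _ _ _ _ B0 _ _ _ x0 y0).
  by apply: seq_equiv_sym; apply/s0.
by apply/s0.
Qed.

Lemma real_exists A D (d : E D A) :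
  exists B (x : mor A B) (y : mor B D), s d x y.
Proof.
have [[[[clS _] _] _ _] _] := exS.
have [B [x [y sB]]] := clS _ _ d; exists B, x, y; apply/sB.
exists (idm B); split; rewrite ?mcomp1m ?mcompm1 //; exact: is_iso_id.
Qed.

Lemma real_morph D A D' A' (d : E D A) (d' : E D' A') (a : mor A A')
    (c : mor D D') B B' (x : mor A B) (y : mor B D)
    (x' : mor A' B') (y' : mor B' D') :
  s d x y -> s d' x' y' -> push a d = pull c d' ->
  exists b : mor B B', b \oc x = x' \oc a /\ y' \oc b = c \oc y.
Proof.
have [[[[_ +] _] _ _] _] := exS.
by move=> morS xy xy' ac; apply: (morS _ _ _ _ d d').
Qed.

Lemma real_zero D A : s (0 : E D A) (inl_ A D) (prr_ A D).
Proof. by have [[[_ [zeroS _]] _ _] _] := exS; apply: zeroS. Qed.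

Lemma etriangle_iso A B D (x : mor A B) (y : mor B D) B' (b : mor B B') :
  etriangle s x y -> is_iso b ->
  exists y' : mor B' D, etriangle s (b \oc x) y'.
Proof.
case=> d xy [b' [b'b bb']]; exists (y \oc b'), d.
apply: real_equiv xy _; exists b; split=> //; first by exists b'.
by rewrite -mcompA b'b mcompm1.
Qed.

Lemma etriangle_isor A B D (x : mor A B) (y : mor B D) B' :
  etriangle s x y -> isomorphic B B' ->
  exists (x' : mor A B') (y' : mor B' D), etriangle s x' y'.
Proof.
move=> xy [b b_iso]; have [y' xy'] := etriangle_iso xy b_iso.
by exists (b \oc x), y'.
Qed.

Lemma split_etriangle A D : etriangle s (inl_ A D) (prr_ A D).
Proof. by exists 0; apply: real_zero. Qed.

Lemma split_iso A B D (x : mor A B) (y : mor B D) :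
  s (0 : E D A) x y -> isomorphic B (bip A D).
Proof.
move=> xy; have [b [b_iso _ _]] := real_unique xy (real_zero D A).
by exists b.
Qed.

Lemma split_section A B D (x : mor A B) (y : mor B D) :
  s (0 : E D A) x y -> exists w : mor D B, y \oc w = idm D.
Proof.
move=> xy; have [b [_ _ yb]] := real_unique (real_zero D A) xy.
by exists (b \oc inr_ A D); rewrite mcompA yb prr_inr.
Qed.

Lemma split_swap A B D (x : mor A B) (y : mor B D) :
  s (0 : E D A) x y ->
  exists (x' : mor D B) (y' : mor B A), etriangle s x' y'.
Proof.
move=> /split_iso/isomorphic_sym AD_B; apply: etriangle_isor (split_etriangle D A) _.
by apply: isomorphic_trans AD_B; exists (swap D A); apply: swap_iso.
Qed.

Lemma ext_zerol Z A (d : E Z A) : is_zero Z -> d = 0.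
Proof. by move=> Z0; rewrite -(pull1 d) (is_zero_id Z0) pull0m. Qed.

Lemma ext_zeror D Z (d : E D Z) : is_zero Z -> d = 0.
Proof. by move=> Z0; rewrite -(push1 d) (is_zero_id Z0) push0m. Qed.

(** An extension of a zero object is zero, hence the triangle splits. *)
Lemma etriangle_zeror A B Z (x : mor A B) (y : mor B Z) :
  is_zero Z -> etriangle s x y -> isomorphic B A.
Proof.
move=> Z0 [d]; rewrite (ext_zerol d Z0) => /split_iso BAZ.
apply: isomorphic_trans BAZ _; apply: isomorphic_sym.
by exists (inl_ A Z); apply: inl_iso.
Qed.

(** The axiom (ET3) of [opReal s] read back in [C], where the two triangles exchange their roles. *)
Lemma ET3op D A D' A' (d : E D A) (d' : E D' A') B B' (x : mor A B)
    (y : mor B D) (x' : mor A' B') (y' : mor B' D') (b : mor B B')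
    (c : mor D D') :
  s d x y -> s d' x' y' -> y' \oc b = c \oc y ->
  exists a : mor A A', push a d = pull c d' /\ x' \oc a = b \oc x.
Proof.
have [_ [ET3o _]] := exS => xy xy' bc.
have [a [ad xa]] := ET3o _ _ _ _ d' d _ _ _ _ _ _ c b xy' xy bc.
by exists a; split.
Qed.

(** The dual of (ET3) is applied to a morphism from the split triangle [Z -> Z (+) 0 -> 0] whose
    last component is zero. *)
Lemma etriangle_lift A B D Z (x : mor A B) (y : mor B D) (g : mor Z B) :
  etriangle s x y -> y \oc g = 0 -> exists a : mor Z A, g = x \oc a.
Proof.
case=> d xy yg.
have [|a [_ xa]] := ET3op (b := g \oc prl_ Z (zob C)) (c := 0)
  (real_zero (zob C) Z) xy.
  by rewrite mcompA yg !mcomp0m.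
by exists a; rewrite xa -mcompA prl_inl mcompm1.
Qed.

(** The part of (ET4) that survives when extension classes are forgotten. Seen as in an exact
    category, [G] is the quotient [K/A], an extension of [K/B] by [B/A]. *)
Lemma etriangle_octahedral A B D K F (f : mor A B) (f' : mor B D)
    (g : mor B K) (g' : mor K F) :
  etriangle s f f' -> etriangle s g g' ->
  exists G (h' : mor K G) (u : mor D G) (v : mor G F),
    etriangle s (g \oc f) h' /\ etriangle s u v.
Proof.
case=> d ff' [d' gg']; have [[_ _ ET4S] _] := exS.
have [G [h [h' [u [v [d'' [[-> _ _] [hh' uv _ _]]]]]]]] :=
  ET4S _ _ _ _ _ _ _ _ _ _ _ ff' gg'.
by exists G, h', u, v; split; [exists d''|exists (push f' d')].
Qed.

(** The dual statement: [G] plays the role of the preimage of [U] under [e]. *)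
Lemma etriangle_octahedral_op U B V W K (a : mor U B) (b : mor B V)
    (c : mor W K) (e : mor K B) :
  etriangle s a b -> etriangle s c e ->
  exists G (h : mor G K) (v : mor W G) (u : mor G U),
    etriangle s h (b \oc e) /\ etriangle s v u.
Proof.
case=> d ab [d' ce]; have [_ [_ ET4o]] := exS.
have [G [h [h' [u [v [d'' [[-> _ _] [hh' uv _ _]]]]]]]] :=
  ET4o _ _ _ _ _ _ _ _ _ _ _ ab ce.
by exists G, h', v, u; split; [exists d''|exists (pull a d')].
Qed.

(* By (ET4) the class [th] pulls back along [v : G -> T] to a pushforward of an
   element of [E G A]; the vanishing of [E T D] gives a section of [v]. *)
Lemma ext_vanish_mid A B D T (x : mor A B) (y : mor B D) :
  etriangle s x y -> (forall d : E T A, d = 0) -> (forall d : E T D, d = 0) ->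
  forall d : E T B, d = 0.
Proof.
case=> d xy A0 D0 th.
have [[_ _ ET4S] _] := exS.
have [K [g [g' gg']]] := real_exists th.
have [G [h [h' [u [v [d'' [_ [_ uv _ xv]]]]]]]] :=
  ET4S _ _ _ _ _ _ _ _ _ _ _ xy gg'.
rewrite (D0 (push y th)) in uv; have [w vw] := split_section uv.
rewrite -(pull1 th) -vw pull_comp -xv -push_pull (A0 (pull w d'')).
by rewrite -(pull0m T (0 : E T A)) push_pull pull0m.
Qed.

(* [(f, x)] is the composite of the split inflation [(f, 1)] and the direct sum
   of [x] with the identity of [F]. *)
Lemma pair_inflation A B D F (x : mor A B) (y : mor B D) (f : mor A F) :
  etriangle s x y -> exists G (z : mor (bip F B) G), etriangle s (pair f x) z.
Proof.
case=> d xy; have [[[_ [_ addS]] _ _] _] := exS.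
have sum_xy := addS _ _ _ _ _ _ _ _ _ _ _ _ (real_zero (zob C) F) xy.
pose h := copair (inl_ F B \oc prl_ F (zob C)) (inr_ F B).
have h_iso : is_iso h.
  exists (copair (inl_ _ _ \oc inl_ F (zob C)) (inr_ _ _)); split.
    apply: bip_ext; rewrite -mcompA mcomp1m ?copair_inl ?copair_inr //.
    rewrite mcompA copair_inl -mcompA -[RHS]mcompm1; congr (_ \oc _).
    by rewrite -bip_id (zob_terminal (prr_ F (zob C))) mcompm0 addr0.
  apply: bip_ext; rewrite -mcompA mcomp1m ?copair_inl ?copair_inr //.
  by rewrite mcompA copair_inl -mcompA prl_inl mcompm1.
have [z1 tri1] := etriangle_iso (ex_intro _ _ sum_xy) h_iso.
(* A swap followed by a shear: it carries the canonical inclusion of [A] to [(f, 1)]. *)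
pose k := copair (pair f (idm A)) (inl_ F A).
have k_iso : is_iso k.
  exists (copair (inr_ A F) (inl_ A F - inr_ A F \oc f)).
  split; apply: bip_ext; rewrite -mcompA mcomp1m.
  - rewrite copair_inl mcompDr !mcompA copair_inl copair_inr mcompm1.
    by rewrite addrC subrK.
  - by rewrite copair_inr copair_inl.
  - by rewrite copair_inl copair_inr.
  - rewrite copair_inr mcompDr mcompNr mcompA copair_inl copair_inr.
    by rewrite /pair mcompm1 addrAC subrr add0r.
have [z2 tri2] := etriangle_iso (split_etriangle A F) k_iso.
have [G [z [u [v [tri _]]]]] := etriangle_octahedral tri2 tri1.
exists G, z; move: tri; congr (etriangle s _ z).
rewrite copair_inl /map_bip /h.
rewrite mcompDr !mcompA copair_inl copair_inr.
rewrite -[_ \oc prl_ F _ \oc inl_ F _]mcompA prl_inl mcompm1.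
by rewrite mcompDl -!mcompA prl_pair prr_pair mcompm1.
Qed.

(** * Precovers by extensions, built from injectives *)

Lemma enough_injectives_inflation A : enough_injectives s ->
  exists (I G : C) (i : mor A I) (z : mor I G), etriangle s i z /\
    forall B D F (x : mor B D) (y : mor D F), etriangle s x y ->
      forall p : mor B I, exists q : mor D I, p = q \oc x.
Proof.
move=> /(_ A)[G [I [z [i [injI tri]]]]]; exists I, G, i, z; split=> //.
by move=> B D F x y xy p; apply: (injI _ _ _ y x xy p).
Qed.

(* Let [f : X0 -> D] be an [X]-precover and [i : X0 -> I] an inflation into an
   injective, and complete [(f, i)] to an E-triangle
   [X0 -> D (+) I -> G]. Pulling it back along a [Y]-precover [Y0 -> G] gives
   [X0 -> Z0 -> Y0], and [Z0 -> D (+) I -> D] is the required precover. *)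
Lemma precovering_star (X Y : C -> Prop) : enough_injectives s ->
  precovering X -> precovering Y -> precovering (star s X Y).
Proof.
move=> enS preX preY D.
have [X0 [f [XX0 fP]]] := preX D.
have [I [? [i [? [itri injI]]]]] := enough_injectives_inflation X0 enS.
have [G [z [rho rhoS]]] := pair_inflation f itri.
have [Y0 [g [YY0 gP]]] := preY G.
have [Z0 [x0 [y0 Z0S]]] := real_exists (pull g rho).
have [|b [bx zb]] := real_morph (a := idm X0) (c := g) Z0S rhoS.
  by rewrite push1.
rewrite mcompm1 in bx.
exists Z0, (prl_ D I \oc b); split.
  by exists X0, Y0, x0, y0; split=> //; exists (pull g rho).
move=> Z [X1 [Y1 [x [y [XX1 YY1 [d xyS]]]]]] phi.
(* To lift [phi : Z -> D], first lift its restriction to [X1] through [f], then extend [i \oc a]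
   along [x] by injectivity. Thus [(phi, j)] restricts on [X1] to [(f, i) \oc a], and (ET3) induces
   a map [u] on the third terms. *)
have [a phix] := fP _ XX1 (phi \oc x).
have [j jx] := injI _ _ _ x y (ex_intro _ d xyS) (i \oc a).
have phijx : pair phi j \oc x = pair f i \oc a.
  by rewrite !mcompDl -!mcompA phix -jx.
have [[_ ET3S _] _] := exS.
have [u [ad uy]] := ET3S _ _ _ _ _ _ _ _ _ _ _ _ _ _ xyS rhoS phijx.
have [v uE] := gP _ YY1 u; rewrite uE in ad uy.
have [|w [wx yw]] := real_morph (a := a) (c := v) xyS Z0S.
  by rewrite ad pull_comp.
(* The maps [(phi, j)] and [b \oc w] agree after [z], so their difference comes from [X0]; adding
   [x0 \oc e] corrects [w]. *)
have [|e eE] := etriangle_lift (g := pair phi j - b \oc w) (ex_intro _ rho rhoS).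
  by rewrite mcompDr mcompNr mcompA zb -mcompA yw mcompA uy subrr.
exists (w + x0 \oc e).
rewrite -mcompA (mcompDr b) mcompA bx -eE addrC subrK.
by rewrite prl_pair.
Qed.

End Realization.

(** The axioms are self-dual; this is what turns statements on precovers into statements on
    preenvelopes. *)
Lemma extriangulated_op (R : comPzRingType) (C : addCat R) (E : bifun C)
  (s : realT E) : extriangulated s -> extriangulated (opReal s).
Proof.
move=> exS; have [[[[clS morS] [_ addS]] ET3S ET4S] [ET3o ET4o]] := exS.
split; last by split; [exact: ET3S | exact: ET4S].
split=> //; split; split.
- move=> A D d; have [B [x [y sB]]] := clS _ _ d.
  exists B, y, x => B' y' x'; split.
    move=> /sB/seq_equiv_sym [b [[b' [b'b bb']] bx yb]].
    by exists b; split=> //; exists b'.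
  case=> b [[b' [b'b bb']] bx yb]; apply/sB; apply: seq_equiv_sym.
  by exists b; split=> //; exists b'.
- move=> A D A' D' d d' c a B B' y x y' x' /esym ac xy xy'.
  have [b [bx yb]] := morS _ _ _ _ _ _ _ _ _ _ _ _ _ _ ac xy' xy.
  by exists b; split.
(* The split sequence of the opposite category has its summands in the other order, and [swap] gives
   the equivalence. *)
- move=> A D; apply: (real_equiv exS (real_zero exS D A)).
  exists (@swap R C A D); split; first exact: swap_iso.
    exact: swap_inl.
  exact: prl_swap.
- move=> A D A' D' d d' B B' y x y' x' xy xy'.
  have := addS _ _ _ _ _ _ _ _ _ _ _ _ xy xy'.
  by rewrite /ext_sum /map_bip /opReal /= !push_pull -!mcompA.
Qed.

(** * Filtrations and their rearrangement *)

Section Filtration.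
Context {R : comPzRingType} {C : addCat R} {E : bifun C} {s : realT E}.
Hypothesis exS : extriangulated s.
Implicit Types (A B D M N T Z : C) (X : C -> Prop).

(** An inductive form of [filtered], suited to induction on the last triangle; the starting triangle
    between zero objects is absorbed into [filt_zero]. *)
Inductive filt X : C -> Prop :=
| filt_zero Z of is_zero Z : filt X Z
| filt_step M N Y (x : mor M N) (y : mor N Y) of
    filt X M & X Y & etriangle s x y : filt X N.

Lemma filt_mono X X' M : (forall Y, X Y -> X' Y) -> filt X M -> filt X' M.
Proof.
move=> XX'; elim=> {M} [Z Z0|M N Y x y _ IH XY xy]; first exact: filt_zero.
by apply: filt_step IH _ xy; apply: XX'.
Qed.

Lemma filt_iso X M N : isomorphic M N -> filt X N -> filt X M.
Proof.
move=> MN XN; case: N / XN MN => [Z Z0|N' N Y x y XN' XY xy] MN.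
  by apply: filt_zero; apply: is_zero_iso Z0.
have [x' [y' xy']] := etriangle_isor exS xy (isomorphic_sym MN).
exact: filt_step XN' XY xy'.
Qed.

(** Induction on the filtration of [D]: its last step [U -> B -> V] pulls back to a last step of
    [M], whose smaller term is an extension of [U] by [A]. *)
Lemma filt_ext X A M D (x : mor A M) (y : mor M D) :
  etriangle s x y -> filt X A -> filt X D -> filt X M.
Proof.
move=> xy XA XD; elim: XD M x y xy => {D} [Z Z0|U B V a b _ IH XV ab] M x y xy.
  exact: filt_iso (etriangle_zeror exS Z0 xy) XA.
have [G [h [v [u [hV vu]]]]] := etriangle_octahedral_op exS ab xy.
exact: filt_step (IH _ _ _ vu) XV hV.
Qed.

Lemma filt_sums X M : sums_of X M -> filt X M.
Proof.
move: M; apply: sums_of_ind => [M N MN||]; first exact: filt_iso.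
  by apply: filt_zero; apply: zob_zero.
move=> A M XA XM.
have [|x [y xy]] := etriangle_isor exS (B' := bip A M) (split_etriangle exS M A).
  by exists (swap M A); apply: swap_iso.
exact: filt_step XM XA xy.
Qed.

Lemma filt_star_pow X n M : star_pow s n (sums_of X) M -> filt X M.
Proof.
elim: n M => [|[|n] IHn] M; first exact: filt_zero.
  exact: filt_sums.
case=> A [D [x [y [/filt_sums XA /IHn XD xy]]]].
exact: filt_ext xy XA XD.
Qed.

Lemma etriangle_zero_zero Z N Z' (x : mor Z N) (y : mor N Z') :
  etriangle s x y -> is_zero Z -> is_zero Z' -> is_zero N.
Proof. by move=> xy Z0 Z'0; apply: is_zero_iso (etriangle_zeror exS Z'0 xy) Z0. Qed.

Lemma filteredE X N : filtered s X N <-> filt X N.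
Proof.
split=> [[m [M [Y [[M0 Y0 <-] [XY tri]]]]]|].
  suff: forall k, (k <= m)%N -> filt X (M k.+1) by apply.
  elim=> [|k IHk] lekm; have [x [y xy]] := tri _ lekm.
    exact: filt_zero (etriangle_zero_zero xy M0 Y0).
  by apply: filt_step xy; [apply: IHk; apply: ltnW|apply: XY].
elim=> {N} [Z Z0|N0 N T x y _ [m [M [Y [[M0 Y0 MN] [XY tri]]]]] XT xy].
  (* Even a filtration without factors contains one triangle, here [0 -> Z -> 0]. *)
  exists 0, (fun k => if k is 0 then zob C else Z), (fun _ => zob C).
  split; first by split=> //; apply: zob_zero.
  split; first by case.
  case=> // _; apply: (etriangle_isor exS (split_etriangle exS (zob C) (zob C))).
  exact: is_zero_isomorphic (etriangle_zero_zero (split_etriangle exS _ _)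
    zob_zero zob_zero) Z0.
(* Because of the index shift the old terms run up to [m.+1] and the old factors up to [m]; [N] and
   [T] are appended after them. *)
exists m.+1, (fun k => if (k <= m.+1)%N then M k else N),
  (fun k => if (k <= m)%N then Y k else T); split.
  by rewrite !leq0n ltnn.
split=> [i /andP[i0 _] /=|i].
  by case: leqP => // im; apply: XY; rewrite i0.
move=> le_i; case: (eqVneq i m.+1) => [->|neq_i] /=.
  by rewrite leqnn !ltnn MN; exists x, y.
have im : (i <= m)%N by rewrite -ltnS ltn_neqAle neq_i.
by rewrite le_i ltnS im; apply: tri.
Qed.

Lemma filt_ext_vanish X T M : (forall Y, X Y -> forall d : E T Y, d = 0) ->
  filt X M -> forall d : E T M, d = 0.
Proof.
move=> vanX; elim=> {M} [Z Z0 d|M N Y x y _ IH XY xy].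
  exact: ext_zeror.
exact: (ext_vanish_mid exS xy IH (vanX _ XY)).
Qed.

(* When [T] is attached on top of [A -> M -> D], the extension of [T] by [D]
   splits, so that [T] slides below [D]; the extension of [T] by [A] splits as
   well, so that [T] joins [A] as a direct summand. *)
Lemma filt_split_off X T M : (forall Y, X Y -> forall d : E T Y, d = 0) ->
  (forall d : E T T, d = 0) -> filt (fun Y => Y = T \/ X Y) M ->
  star s (sums_of (eq^~ T)) (filt X) M.
Proof.
move=> vanX vanT; elim=> {M} [Z Z0|M N Y x y _ [A [D [a [b [TA XD ab]]]]] TXY xy].
  have [|x [y xy]] := etriangle_isor exS (split_etriangle exS (zob C) (zob C))
    (B' := Z).
    apply: is_zero_isomorphic Z0.
    exact: etriangle_zero_zero (split_etriangle exS _ _) zob_zero zob_zero.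
  exists (zob C), (zob C), x, y; split=> //.
    exact: sums_of_zero zob_zero.
  exact: filt_zero zob_zero.
have [G [h [u [v [xh uv]]]]] := etriangle_octahedral exS ab xy.
case: TXY => [YT|XY]; last first.
  by exists A, G, (x \oc a), h; split=> //; apply: filt_step uv.
subst Y; case: uv => d; rewrite (filt_ext_vanish vanX XD d).
move=> /(split_swap exS)[u' [v' uv']].
have [G' [k [w [z [kD wz]]]]] := etriangle_octahedral_op exS uv' xh.
exists G', D, k, (v' \oc h); split=> //.
have vanA (d' : E T A) : d' = 0.
  by apply: filt_ext_vanish (filt_sums TA) d' => _ ->.
case: wz => d'; rewrite (vanA d').
move=> /(split_iso exS) G'AT.
apply: (@sums_of_iso _ _ _ _ (bip T A)); last exact: sums_of_cons.
apply: isomorphic_trans G'AT _.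
by exists (swap A T); apply: swap_iso.
Qed.

Lemma sums_of_mono X X' M :
  (forall Y, X Y -> X' Y) -> sums_of X M -> sums_of X' M.
Proof. by move=> XX' [n [F [XF MF]]]; exists n, F; split=> // i; apply: XX'. Qed.

(** Induction on a list with the largest index first. Extensions of [Theta j], for [j] the head, by
    any member of the list vanish, so [filt_split_off] peels off the copies of [Theta j] and leaves
    an object filtered by the tail. *)
Lemma filt_star_pow_sorted (I : eqType) (le : rel I) (Theta : I -> C) (l : seq I) M :
  reflexive le ->
  (forall i j, le i j -> forall d : E (Theta j) (Theta i), d = 0) ->
  pairwise (fun j i => le i j) l ->
  filt (fun Y => exists2 i, i \in l & Y = Theta i) M ->
  star_pow s (size l) (sums_of (range_of Theta)) M.
Proof.
move=> le_refl van; elim: l M => [|j l IHl] M /=.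
  by move=> _; case: M / => // M N Y x y _ [].
case/andP=> /allP lj sorted_l lM.
have /filt_split_off [] : filt (fun Y => Y = Theta j \/
    exists2 i, i \in l & Y = Theta i) M.
- apply: filt_mono lM => _ [i + ->]; rewrite inE => /predU1P[->|il]; first by left.
  by right; exists i.
- by move=> _ [i /lj le_ij ->]; apply: van.
- by apply: van.
move=> A [D [x [y [jA lD xy]]]].
have {}jA : sums_of (range_of Theta) A.
  by apply: sums_of_mono jA => _ ->; exists j.
have {IHl lD} := IHl _ sorted_l lD.
(* The first power is the class itself, without a trailing zero factor; for an empty tail [D] is
   zero and [M] is isomorphic to [A]. *)
case: (size l) => [D0|n nD]; last by exists A, D, x, y.
exact: sums_of_iso (etriangle_zeror exS D0 xy) jA.
Qed.

End Filtration.

(** * Functorial finiteness of the powers, and the conclusion *)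

Lemma precovering_star_pow (R : comPzRingType) (C : addCat R) (E : bifun C)
    (s : realT E) (X : C -> Prop) n : extriangulated s ->
  enough_injectives s -> precovering X -> precovering (star_pow s n X).
Proof.
move=> exS enS preX; elim: n => [|[|n] IHn] //; first exact: precovering_zero.
exact: (precovering_star exS enS preX IHn).
Qed.

Lemma preenveloping_star_pow (R : comPzRingType) (C : addCat R) (E : bifun C)
    (s : realT E) (X : C -> Prop) n : extriangulated s ->
  enough_projectives s -> preenveloping X -> preenveloping (star_pow s n X).
Proof.
move=> exS enS preX; elim: n => [|[|n] IHn] //.
  apply: eq_precovering (@precovering_zero R (opCat C)) => M.
  by split=> [] [].
(* Passing to the opposite reverses the two factors of [star], which is why the power comes first
   here. The hypothesis [enS] serves as enough injectives for [opReal s]. *)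
have := precovering_star (extriangulated_op exS) enS IHn preX.
apply: eq_precovering => M.
by split=> -[A [D [x [y [XA YD [d xy]]]]]]; exists D, A, y, x; split=> //; exists d.
Qed.

(** Both categories share their biproducts, so the classes of finite sums coincide once isomorphisms
    are inverted. *)
Lemma preenveloping_sums (R : comPzRingType) (C : addCat R) (t : nat)
    (Theta : 'I_t -> C) : (forall X Y : C, fin_gen (mor X Y)) ->
  preenveloping (sums_of (range_of Theta)).
Proof.
move=> fg.
apply: eq_precovering (@precovering_sums R (opCat C) t Theta (fun X Y => fg Y X)).
move=> M; split=> [] [n [F [XF [f [g [gf fg']]]]]]; exists n, F;
  by split=> //; exists g, f.
Qed.

Theorem theorem3p11 (R : comPzRingType) (artR : artinian R)
  (C : addCat R) (E : bifun C) (s : realT E)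
  (artC : artin_extriangulated s)
  (enough_proj : enough_projectives s) (enough_inj : enough_injectives s)
  (t : nat) (Theta : 'I_t -> C) (le : rel 'I_t) (le_lin : linear_order le)
  (ext_vanish : forall i j : 'I_t, le i j ->
     forall d : E (Theta j) (Theta i), d = 0) :
  (forall M : C, filtered s (range_of Theta) M <->
                 star_pow s t (sums_of (range_of Theta)) M) /\
  functorially_finite (filtered s (range_of Theta)).
Proof.
have [exS fg _ _] := artC.
have [le_refl le_anti le_trans le_total] := le_lin.
have filtE M : filtered s (range_of Theta) M <->
               star_pow s t (sums_of (range_of Theta)) M.
  apply: iff_trans (filteredE exS _ _) _; split; last exact: (filt_star_pow exS).
  (* The indices are sorted in decreasing order, since the largest one is split off first. *)
  pose ge := fun j i : 'I_t => le i j.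
  pose l := sort ge (enum 'I_t).
  have size_l : size l = t by rewrite size_sort size_enum_ord.
  have ge_trans : transitive ge by move=> j i k ij jk; apply: le_trans ij.
  move=> XM; rewrite -[X in star_pow s X]size_l.
  apply: (filt_star_pow_sorted exS le_refl ext_vanish).
    rewrite -/ge -sorted_pairwise //; apply: sort_sorted => i j.
    exact: le_total.
  apply: filt_mono XM => _ [i ->]; exists i => //.
  by rewrite mem_sort mem_enum.
split=> //; split.
  apply: (eq_precovering (fun M => iff_sym (filtE M))).
  exact: precovering_star_pow exS enough_inj (precovering_sums Theta fg).
apply: (@eq_precovering R (opCat C) _ _ (fun M => iff_sym (filtE M))).
exact: preenveloping_star_pow exS enough_proj (preenveloping_sums Theta fg).
Qed.
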